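(* The formula with reversal $\phi_1 = xy_1x\cdot y_1^R$ is $4$-avoidable. Moreover, the number of words of length $N$ over a $4$-letter alphabet that avoid $\phi_1$ grows exponentially in $N$.
   Context: Let $\Sigma$ be a set of variables and $\Sigma^R=\{x^R:x\in\Sigma\}$. For words, $(a_1\cdots a_n)^R=a_n\cdots a_1$. A morphism $h$ on $(\Sigma\cup\Sigma^R)^*$ respects reversal if $h(x^R)=h(x)^R$. The formula $\phi_1$ consists of the fragments $xy_1x$ and $y_1^R$; it occurs in a word $u$ if there is a non-erasing morphism $h$ respecting reversal with $h(xy_1x)$ and $h(y_1)^R$ both factors of $u$; otherwise $u$ avoids it. A formula is $k$-avoidable if infinitely many words over a $k$-letter alphabet avoid it. *)

(* Defs.v *)
From mathcomp Require Import all_boot all_order all_algebra.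
From mathcomp Require Import boolp classical_sets cardinality reals.

Set Implicit Arguments.
Unset Strict Implicit.
Unset Printing Implicit Defensive.

Import Order.TTheory GRing.Theory Num.Theory.

(* A letter of V + V is a variable [inl x] or its formal reversal [inr x]. *)
Definition pattern (V : Type) := seq (V + V).

(* A formula is the sequence of its fragments. *)
Definition formula (V : Type) := seq (pattern V).

Definition is_morphism (B A : Type) (h : seq B -> seq A) : Prop :=
  {morph h : u v / u ++ v}.

Definition nonerasing (B A : Type) (h : seq B -> seq A) : Prop :=
  forall b : B, h [:: b] <> [::].

Definition respects_reversal (V A : Type) (h : pattern V -> seq A) : Prop :=
  forall x : V, h [:: inr x] = rev (h [:: inl x]).

Definition occurs (V : Type) (A : eqType) (phi : formula V) (u : seq A) : Prop :=
  exists h : pattern V -> seq A,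
    [/\ is_morphism h, nonerasing h, respects_reversal h
      & all (fun p => infix (h p) u) phi].

Definition avoids (V : Type) (A : eqType) (phi : formula V) (u : seq A) : Prop :=
  ~ occurs phi u.

Definition avoidable (V : Type) (k : nat) (phi : formula V) : Prop :=
  infinite_set [set u : seq 'I_k | avoids phi u]%classic.

Definition num_avoiding (V : Type) (k : nat) (phi : formula V) (N : nat) : nat :=
  #|[pred u : N.-tuple 'I_k | `[< avoids phi u >]]|.

Definition exponential_growth (R : realType) (f : nat -> nat) : Prop :=
  (exists C c : R, [/\ 0 < C, 1 < c & forall N, C * c ^+ N <= (f N)%:R])%R /\
  (exists D d : R, [/\ 0 < D, 1 < d & forall N, (f N)%:R <= D * d ^+ N])%R.

Inductive var := var_x | var_y1.

Definition phi1 : formula var :=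
  [:: [:: inl var_x; inl var_y1; inl var_x]; [:: inr var_y1]].

(* Main.v *)
Require Import Defs.
From mathcomp Require Import all_boot all_order all_algebra.
From mathcomp Require Import boolp classical_sets cardinality reals.
From mathcomp Require Import zify lra.

(* An 18-uniform morphism from 4 letters to 4 letters is applied to square-free
   words, of which there are at least 2^n of length n over 4 letters.

   In the images, the letters run through the cyclic order 0, 1, 2, 3 with runs
   of length 1 or 2, so the only factors whose reversal is also a factor are
   a and aa. It remains to exclude XYX with Y = a or Y = aa. For |X| < 10 this
   is a finite check. For |X| >= 10, a factor of length 10 determines its
   position modulo 18, so |XY| is a multiple of 18, and XYX, which falls short
   of a square by at most two letters, comes from a square in the preimage. *)

Set Implicit Arguments.
Unset Strict Implicit.
Unset Printing Implicit Defensive.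

Import Order.TTheory GRing.Theory Num.Theory.

(** * Square-free words and their number *)

Definition square_free (T : eqType) (w : seq T) : Prop :=
  forall x : seq T, x != [::] -> ~~ infix (x ++ x) w.

Lemma square_free_infix (T : eqType) (v w : seq T) :
  infix v w -> square_free w -> square_free v.
Proof.
move=> vw sfw x x0; apply: contra (sfw x x0) => xv.
exact: infix_trans xv vw.
Qed.

(** Translates square-freeness into equalities between positions, the form in which it is assumed of
    preimages below. *)
Lemma square_free_nth (T : eqType) (x0 : T) (w : seq T) i q :
  square_free w -> 0 < q -> i + q.*2 <= size w ->
  ~ (forall j, j < q -> nth x0 w (i + j) = nth x0 w (i + q + j)).
Proof.
move=> sfw q0 iqw eqw; pose x := take q (drop i w).
have sx : size x = q by rewrite size_takel // size_drop; lia.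
have xN0 : x != [::] by rewrite -size_eq0 sx -lt0n.
suff E : take q.*2 (drop i w) = x ++ x.
  have /negP := sfw x xN0; apply; rewrite -E.
  apply/infixP; exists (take i w), (drop q.*2 (drop i w)).
  by rewrite !cat_take_drop.
rewrite -addnn takeD; congr (_ ++ _).
apply: (@eq_from_nth _ x0) => [|j].
  by rewrite sx size_takel // !size_drop; lia.
rewrite size_takel; last by rewrite !size_drop; lia.
by move=> jq; rewrite !nth_take // !nth_drop addnA eqw.
Qed.

Fixpoint square_free_words (T : finType) (n : nat) : seq (seq T) :=
  if n is m.+1 then
    [seq w <- [seq a :: v | a <- enum T, v <- square_free_words T m]
       | `[< square_free w >]]
  else [:: [::]].

Section SquareFreeWords.
Variable T : finType.
Local Notation sfw := (square_free_words T).

Lemma mem_square_free_words n (w : seq T) :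
  w \in sfw n <-> size w = n /\ square_free w.
Proof.
elim: n w => [|n IHn] w /=.
  rewrite inE; split => [/eqP -> | [/size0nil -> //]].
  split=> // x x0.
  by rewrite infixs0 -size_eq0 size_cat addn_eq0 size_eq0 (negPf x0).
rewrite mem_filter; split.
  case/andP=> /asboolP sf /allpairsP[[a v] /= [_ /IHn[sv _] wE]].
  by rewrite wE /= sv -wE.
case: w => [[]//|a v] [[sv] sf]; apply/andP; split; first exact/asboolP.
apply/allpairsP; exists (a, v); split; rewrite ?mem_enum //.
apply/IHn; split=> //; apply: square_free_infix sf.
exact: infix_cons.
Qed.

Lemma square_free_words_uniq n : uniq (sfw n).
Proof.
elim: n => //= n IHn; apply/filter_uniq/allpairs_uniq; rewrite ?enum_uniq //.
by case=> [a v] [b u] _ _ [-> ->].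
Qed.

(* A word [a :: v] with [v] square-free fails to be square-free only through a
   square prefix [x ++ x], so it is determined by the shorter square-free word
   obtained by deleting the first copy of [x]. *)
Lemma leq_extensions_square_free_words n :
  #|T| * size (sfw n) <=
  size (sfw n.+1) + \sum_(m < n.+1) size (sfw m).
Proof.
set E := [seq a :: v | a <- enum T, v <- sfw n].
have -> : #|T| * size (sfw n) = size E by rewrite size_allpairs cardE.
rewrite -(count_predC (fun w => `[< square_free w >])) -!size_filter /= -/E.
rewrite leq_add2l.
(* If [v = x ++ t] is what remains of [x ++ x ++ t], of length [n.+1], then [n.+1 - size v] is the
   length of [x], so [take (n.+1 - size v) v ++ v] restores the deleted copy. *)
pose V := flatten [seq sfw m | m <- index_iota 0 n.+1].
have -> : \sum_(m < n.+1) size (sfw m)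
          = size [seq take (n.+1 - size v) v ++ v | v <- V].
  rewrite size_map size_flatten /shape -map_comp sumnE big_map.
  by rewrite -(big_mkord xpredT (fun m => size (sfw m))).
apply: uniq_leq_size.
  apply/filter_uniq/allpairs_uniq;
    rewrite ?enum_uniq ?square_free_words_uniq //.
  by case=> [a v] [b u] _ _ [-> ->].
move=> w; rewrite mem_filter => /andP[/asboolPn nsf].
case/allpairsP=> [[a v] /= [_ /mem_square_free_words[sv sfv] wE]].
have [x xN0 xw] : exists2 x, x != [::] & infix (x ++ x) w.
  apply: contrapT => nex; apply: nsf => x x0.
  by apply/negP => xw; apply: nex; exists x.
move: xw; rewrite wE infix_consl (negPf (sfv x xN0)) orbF => /prefixP[t awE].
have x1 : 0 < size x by rewrite lt0n size_eq0.
have sE : n.+1 = size x + (size x + size t).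
  by have := congr1 size awE; rewrite /= !size_cat sv addnA.
have inV : x ++ t \in V.
  apply/flatten_mapP; exists (size (x ++ t)).
    by rewrite mem_index_iota size_cat; lia.
  apply/mem_square_free_words; split=> //; apply: square_free_infix sfv.
  case: x {xN0 sE} x1 awE => // b x _ [_ ->].
  by rewrite -catA; apply: suffix_infix; apply: suffix_suffix.
have -> : a :: v = take (n.+1 - size (x ++ t)) (x ++ t) ++ (x ++ t).
  by rewrite awE -catA {1}size_cat sE addnK take_size_cat.
exact: (map_f (fun v => take (n.+1 - size v) v ++ v) inV).
Qed.

Lemma square_free_words_double : 4 <= #|T| -> forall n,
  2 * size (sfw n) <= size (sfw n.+1).
Proof.
(* This geometric bound turns the previous inequality into doubling, and doubling in turn carries
   the bound from [n] to [n.+1]. *)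
move=> T4 n; suff : \sum_(m < n.+1) size (sfw m) <= 2 * size (sfw n).
  have := leq_extensions_square_free_words n.
  have : 4 * size (sfw n) <= #|T| * size (sfw n) by rewrite leq_mul2r T4 orbT.
  lia.
elim: n => [|n IHn]; first by rewrite big_ord_recr big_ord0.
have := leq_extensions_square_free_words n.
have : 4 * size (sfw n) <= #|T| * size (sfw n) by rewrite leq_mul2r T4 orbT.
have -> : \sum_(m < n.+2) size (sfw m) =
          \sum_(m < n.+1) size (sfw m) + size (sfw n.+1).
  exact: big_ord_recr.
move: (\sum_(m < n.+1) size (sfw m)) (size (sfw n)) (size (sfw n.+1)) IHn.
lia.
Qed.

Lemma exp2_leq_square_free_words n : 4 <= #|T| -> 2 ^ n <= size (sfw n).
Proof.
move=> T4; elim: n => // n IHn.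
by rewrite expnS (leq_trans _ (square_free_words_double T4 n)) // leq_mul2l.
Qed.

End SquareFreeWords.

(** * The 18-uniform morphism and its finite checks *)

Definition codewords : seq (seq nat) :=
  [:: [:: 0;0;1;1;2;2;3;0;1;2;3;3;0;0;1;1;2;3];
      [:: 0;0;1;2;2;3;0;1;1;2;2;3;3;0;1;1;2;3];
      [:: 0;0;1;2;2;3;3;0;0;1;2;3;3;0;1;1;2;3];
      [:: 0;1;2;2;3;3;0;0;1;1;2;2;3;3;0;1;2;3]].

Definition codeword (a : nat) : seq nat := nth [::] codewords a.

Definition encode (w : nat -> nat) (i : nat) : nat :=
  nth 0 (codeword (w (i %/ 18))) (i %% 18).

(** Images of the square-free words of length 3. From any offset [r < 18] at least 36 letters
    remain, enough for every check below. *)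
Definition triple_codes : seq (seq nat) :=
  [seq codeword t.1.1 ++ codeword t.1.2 ++ codeword t.2
     | t <- [seq t <- [seq (ab, c)
                         | ab <- [seq (a, b) | a <- iota 0 4, b <- iota 0 4],
                           c <- iota 0 4]
               | (t.1.1 != t.1.2) && (t.1.2 != t.2)]].

Definition step_ok (s : seq nat) : bool :=
  match s with
  | a :: b :: c :: _ =>
      ((b == a) || (b == a.+1 %% 4)) && ~~ ((a == b) && (b == c))
  | _ => false
  end.

Lemma codes_step :
  all (fun s => all (fun r => step_ok (drop r s)) (iota 0 18)) triple_codes.
Proof. by vm_compute. Qed.

(* If [s] starts with XYX, |X| = x, |Y| = y <= 2, then Y is neither a nor aa. *)
Definition gap_ok (s : seq nat) (x y : nat) : bool :=
  (take x s == take x (drop (x + y) s)) ==>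
  ((y == 2) && (nth 0 s x != nth 0 s x.+1)).

Lemma codes_gap :
  all (fun s => all (fun r => all (fun x =>
    all (gap_ok (drop r s) x) (iota 1 2)) (iota 1 9)) (iota 0 18)) triple_codes.
Proof. by vm_compute. Qed.

(** Since [undup] merges equal pairs, distinct first components mean that a factor of length 10
    determines its offset in the block. *)
Definition windows : seq (seq nat * nat) :=
  undup [seq (take 10 (drop r s), r) | s <- triple_codes, r <- iota 0 18].

Lemma windows_uniq : uniq (unzip1 windows).
Proof. by vm_compute. Qed.

Lemma uniq_map_inj (T1 T2 : eqType) (f : T1 -> T2) (s : seq T1) :
  uniq (map f s) -> {in s &, injective f}.
Proof.
move=> /(uniqP _) fU x y xs ys fxy.
have := fU (f x) (index x s) (index y s).
rewrite !inE size_map !index_mem !(nth_map x) ?index_mem // !nth_index //.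
by move=> /(_ xs ys fxy) E; rewrite -(nth_index x xs) E nth_index.
Qed.

Lemma size_codeword a : a < 4 -> size (codeword a) = 18.
Proof. by case: a => [|[|[|[|a]]]]. Qed.

(** Seven letters are necessary: the second and third codewords share their first six. *)
Lemma codeword_inj_prefix a b : a < 4 -> b < 4 ->
  (forall c, c < 7 -> nth 0 (codeword a) c = nth 0 (codeword b) c) -> a = b.
Proof.
move=> a4 b4 E.
have aI : a \in iota 0 4 by rewrite mem_iota.
have bI : b \in iota 0 4 by rewrite mem_iota.
have check : all (fun a => all (fun b =>
    (take 7 (codeword a) ==
     take 7 (codeword b)) ==> (a == b)) (iota 0 4))
    (iota 0 4) by vm_compute.
apply/eqP; apply: (implyP (allP (allP check a aI) b bI)).
apply/eqP/(@eq_from_nth _ 0) => [|c]; rewrite !size_takel ?size_codeword //.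
by move=> c7; rewrite !nth_take // E.
Qed.

Lemma codeword_inj_middle a b : a < 4 -> b < 4 ->
  (forall c, 8 <= c < 16 -> nth 0 (codeword a) c = nth 0 (codeword b) c) ->
  a = b.
Proof.
move=> a4 b4 E.
have aI : a \in iota 0 4 by rewrite mem_iota.
have bI : b \in iota 0 4 by rewrite mem_iota.
have check : all (fun a => all (fun b =>
    (take 8 (drop 8 (codeword a)) ==
     take 8 (drop 8 (codeword b))) ==> (a == b)) (iota 0 4))
    (iota 0 4) by vm_compute.
apply/eqP; apply: (implyP (allP (allP check a aI) b bI)).
apply/eqP/(@eq_from_nth _ 0) => [|c].
  by rewrite !size_takel ?size_drop ?size_codeword.
rewrite size_takel ?size_drop ?size_codeword // => c8.
by rewrite !nth_take // !nth_drop E //; lia.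
Qed.

Lemma triple_codes_size s : s \in triple_codes -> size s = 54.
Proof.
have A : all (fun s => size s == 54) triple_codes by vm_compute.
by move/(allP A)/eqP.
Qed.

(** * Repetitions and reversals in the encoded word *)

Section Encode.
Variables (n : nat) (w : nat -> nat).
Hypothesis w_lt4 : forall i, w i < 4.
Hypothesis w_square_free : forall i q, 0 < q -> i + q.*2 <= n ->
  ~ (forall j, j < q -> w (i + j) = w (i + q + j)).

Lemma encode_preimage_neq i : i.+1 < n -> w i != w i.+1.
Proof.
move=> iN; apply/eqP => E; apply: (@w_square_free i 1) => //; first lia.
by case=> // _; rewrite !addn0 addn1.
Qed.

Lemma encode_lt4 i : encode w i < 4.
Proof.
have allC : all (all (fun c => c < 4)) codewords by [].
have /(allP allC)/allP C : codeword (w (i %/ 18)) \in codewords.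
  exact: mem_nth.
by apply/C/mem_nth; rewrite size_codeword // ltn_mod.
Qed.

Lemma encode_block b c : c < 18 ->
  encode w (b * 18 + c) = nth 0 (codeword (w b)) c.
Proof.
move=> c18; rewrite /encode divnMDl // modnMDl.
by rewrite divn_small // modn_small // addn0.
Qed.

(** Carries the finite checks over to the encoded word: the window lies in the images of three
    consecutive letters, adjacent ones being distinct. *)
Lemma encode_window i : i %/ 18 + 2 < n ->
  exists2 s, s \in triple_codes &
    forall j, j < 36 -> encode w (i + j) = nth 0 (drop (i %% 18) s) j.
Proof.
set b := i %/ 18 => bn.
exists (codeword (w b) ++ codeword (w b.+1) ++ codeword (w b.+2)).
  apply/mapP; exists (w b, w b.+1, w b.+2) => //.
  rewrite mem_filter; apply/andP; split.
    by rewrite !encode_preimage_neq //; lia.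
  apply/allpairsP; exists ((w b, w b.+1), w b.+2); rewrite mem_iota w_lt4.
  split=> //; apply/allpairsP; exists (w b, w b.+1).
  by rewrite !mem_iota !w_lt4.
move=> j; rewrite nth_drop !nth_cat !size_codeword //.
have iE := divn_eq i 18; rewrite -/b in iE.
have := ltn_pmod i (isT : 0 < 18); move: (i %% 18) iE => r iE r18 rj.
have [H|H] := ltnP (r + j) 18.
  by rewrite -encode_block //; congr encode; lia.
have [H'|H'] := ltnP (r + j - 18) 18.
  by rewrite -encode_block //; congr encode; lia.
by rewrite -encode_block; [congr encode|]; lia.
Qed.

Lemma encode_step i : i %/ 18 + 2 < n ->
  encode w i.+1 = encode w i \/ encode w i.+1 = (encode w i).+1 %% 4.
Proof.
case/encode_window=> s sT E.
have r18 := ltn_pmod i (isT : 0 < 18).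
have /allP/(_ (i %% 18)) := allP codes_step s sT.
rewrite mem_iota /= r18 => /(_ isT).
have -> : encode w i = encode w (i + 0) by rewrite addn0.
rewrite -[i.+1]addn1 !E //.
case: (drop _ s) => [//|a [//|b [//|c t]]] /= /andP[/orP[]/eqP -> _].
- by left.
- by right.
Qed.

Lemma encode_no_cube i : i %/ 18 + 2 < n ->
  encode w i = encode w i.+1 -> encode w i.+1 <> encode w i.+2.
Proof.
case/encode_window=> s sT E.
have r18 := ltn_pmod i (isT : 0 < 18).
have /allP/(_ (i %% 18)) := allP codes_step s sT.
rewrite mem_iota /= r18 => /(_ isT).
have -> : encode w i = encode w (i + 0) by rewrite addn0.
rewrite -[i.+2]addn2 -[i.+1]addn1 !E //.
case: (drop _ s) => [//|a [//|b [//|c t]]] /= /andP[_ ab] eab ebc.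
by move: ab; rewrite -ebc -eab eqxx.
Qed.

(** Three consecutive letters are not all equal, so some step advances by 1 modulo 4. Read backwards
    it becomes a step by -1, which never occurs. *)
Lemma encode_reversal i k :
  i.+1 %/ 18 + 2 < n -> k.+1 %/ 18 + 2 < n ->
  ~ (forall j, j < 3 -> encode w (i + j) = encode w (k + 2 - j)).
Proof.
move=> iN kN E.
have E0 : encode w i = encode w k.+2.
  by have := E 0 isT; rewrite addn0 subn0 addn2.
have E1 : encode w i.+1 = encode w k.+1.
  by have := E 1 isT; rewrite addn1 -addnBA // addn1.
have E2 : encode w i.+2 = encode w k.
  by have := E 2 isT; rewrite addn2 addnK.
have iN' : i %/ 18 + 2 < n by lia.
have kN' : k %/ 18 + 2 < n by lia.
have := encode_step iN; have := encode_step iN'.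
have := encode_step kN; have := encode_step kN'.
have := encode_no_cube iN'.
have := encode_lt4 i; have := encode_lt4 i.+1; have := encode_lt4 i.+2.
rewrite -E0 -E1 -E2; lia.
Qed.

Lemma encode_short_gap i x y :
  i %/ 18 + 2 < n -> 0 < x < 10 -> 0 < y <= 2 ->
  (forall j, j < x -> encode w (i + j) = encode w (i + (x + y) + j)) ->
  y = 2 /\ encode w (i + x) <> encode w (i + x).+1.
Proof.
move=> /encode_window[s sT E] x10 y2 eqE.
have r18 := ltn_pmod i (isT : 0 < 18).
have sS := triple_codes_size sT.
have rI : i %% 18 \in iota 0 18 by rewrite mem_iota.
have xI : x \in iota 1 9 by rewrite mem_iota.
have yI : y \in iota 1 2 by rewrite mem_iota; lia.
have := allP (allP (allP (allP codes_gap s sT) _ rI) x xI) y yI.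
rewrite /gap_ok.
have -> : take x (drop (i %% 18) s) = take x (drop (x + y) (drop (i %% 18) s)).
  apply: (@eq_from_nth _ 0) => [|j].
    by rewrite !size_takel ?size_drop ?drop_drop ?size_drop ?sS //; lia.
  rewrite size_takel ?size_drop ?sS; last lia.
  move=> jx; rewrite !nth_take // (nth_drop (x + y)) -!E; try lia.
  by rewrite eqE //; congr encode; lia.
rewrite eqxx /= => /andP[/eqP -> ]; rewrite -!E; try lia.
by rewrite addnS => /eqP.
Qed.

Lemma encode_sync i k :
  i %/ 18 + 2 < n -> k %/ 18 + 2 < n ->
  (forall j, j < 10 -> encode w (i + j) = encode w (k + j)) ->
  i = k %[mod 18].
Proof.
move=> iN kN eqE.
pose window l := mkseq (fun j => encode w (l + j)) 10.
have win l : l %/ 18 + 2 < n -> (window l, l %% 18) \in windows.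
  case/encode_window=> s sT E; rewrite mem_undup.
  have r18 := ltn_pmod l (isT : 0 < 18).
  have sS := triple_codes_size sT.
  apply/allpairsP; exists (s, l %% 18); rewrite mem_iota /=; split=> //.
  congr pair; apply: (@eq_from_nth _ 0) => [|j].
    by rewrite size_mkseq size_takel // size_drop sS; lia.
  rewrite size_mkseq => j10; rewrite nth_mkseq // nth_take // E //; lia.
have eqw : window i = window k.
  apply: (@eq_from_nth _ 0) => [|j]; rewrite !size_mkseq // => j10.
  by rewrite !nth_mkseq // eqE.
have := win i iN; have := win k kN; rewrite eqw => kW iW.
by have [] := uniq_map_inj windows_uniq iW kW (erefl _).
Qed.

(* By synchronization the period [x + y] is a multiple [18 * q] of the block
   length, and the two copies of [X] miss at most two letters of the period.
   Each block is read off either from its letters 8 to 15 or from its first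
   seven letters, depending on the offset of [X] in its block, so a square of
   period [q] shows up in [w]. *)
Lemma encode_long_gap N i x y :
  N %/ 18 + 3 <= n -> i + (x + y) + x <= N -> 10 <= x -> 0 < y <= 2 ->
  ~ (forall j, j < x -> encode w (i + j) = encode w (i + (x + y) + j)).
Proof.
move=> nN ixN x10 y2 E.
have sync : i = i + (x + y) %[mod 18].
  by apply: encode_sync => [||j j10]; [lia|lia|apply: E; lia].
have /dvdnP[q pE] : 18 %| x + y.
  by rewrite -[x + y](addKn i) -eqn_mod_dvd ?leq_addr // sync.
have iE := divn_eq i 18; have := ltn_pmod i (isT : 0 < 18).
move: (i %/ 18) (i %% 18) iE => b r iE r18.
have shift k c : c < 18 -> i <= k * 18 + c -> k * 18 + c < i + x ->
    nth 0 (codeword (w k)) c = nth 0 (codeword (w (k + q))) c.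
  move=> c18 ik kx; rewrite -!encode_block //.
  have -> : k * 18 + c = i + (k * 18 + c - i) by lia.
  by rewrite E; [congr encode|]; lia.
(* Here [x = 18 * q - y] with [y <= 2]. Letters 8 to 15 of blocks [b] to [b + q - 1] lie in X if
   [r <= 8]. If [r >= 9], then [r - y >= 7] and X contains letters 0 to 6 of blocks [b + 1] to
   [b + q]. *)
have [r8|r8] := leqP r 8.
  apply: (@w_square_free b q); try lia.
  move=> j jq; rewrite (addnAC b); apply: codeword_inj_middle => // c c8.
  by apply: shift; lia.
apply: (@w_square_free b.+1 q); try lia.
move=> j jq; rewrite (addnAC b.+1); apply: codeword_inj_prefix => // c c7.
by apply: shift; lia.
Qed.

(** Excludes XYX at [i] together with the reversal of Y at [k]. Reversal forces [y <= 2]; the gap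
    lemmas then leave only Y = ab with a and b distinct. *)
Lemma encode_no_gap N i k x y :
  N %/ 18 + 3 <= n -> i + (x + y) + x <= N -> k + y <= N -> 0 < x -> 0 < y ->
  (forall j, j < x -> encode w (i + j) = encode w (i + (x + y) + j)) ->
  ~ (forall j, j < y -> encode w (i + x + j) = encode w (k + (y - j.+1))).
Proof.
move=> nN ixN kN x0 y0 EX EY.
have y2 : y <= 2.
  rewrite leqNgt; apply/negP => y3.
  (* The first three letters of Y are the last three of its reversal, backwards. *)
  apply: (@encode_reversal (i + x) (k + (y - 3))); try lia.
  by move=> j j3; rewrite EY; [congr encode|]; lia.
have [x10|x10] := ltnP x 10; last first.
  by apply: (@encode_long_gap N i x y) EX => //; rewrite y0.
have [y2' D] : y = 2 /\ encode w (i + x) <> encode w (i + x).+1.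
  by apply: encode_short_gap EX; lia.
have := EY 0 y0; have := EY 1; rewrite y2' => /(_ isT).
rewrite addn0 addn1 subnn addn0 addn1 => E1 E0.
have /encode_step : (i + x) %/ 18 + 2 < n by lia.
have /encode_step : k %/ 18 + 2 < n by lia.
(* As ab and ba both occur, a and b would each be the cyclic successor of the other, impossible
   modulo 4. *)
have := encode_lt4 k; move: D; rewrite E1 E0; lia.
Qed.

End Encode.

(** * Finite words avoiding [phi1] and a lower bound on their number *)

Definition encode_word (N : nat) (w : seq 'I_4) : N.-tuple 'I_4 :=
  [tuple inord (encode (fun k => nth ord0 w k) i) | i < N].

Lemma nth_encode_word N (w : seq 'I_4) i : i < N ->
  nth ord0 (encode_word N w) i = encode (fun k => nth ord0 w k) i :> nat.
Proof.
move=> iN.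
have -> : nth ord0 (encode_word N w) i = tnth (encode_word N w) (Ordinal iN).
  by rewrite (tnth_nth ord0).
by rewrite tnth_mktuple inordK // encode_lt4 // => k; apply: ltn_ord.
Qed.

Lemma nth_cat_addn (T : Type) (x0 : T) (s t : seq T) j :
  nth x0 (s ++ t) (size s + j) = nth x0 t j.
Proof. by rewrite nth_cat ltnNge leq_addr addKn. Qed.

Lemma phi1_occurs_indices (A : eqType) (a0 : A) (u : seq A) : occurs phi1 u ->
  exists i k x y, [/\ 0 < x, 0 < y, i + (x + y) + x <= size u, k + y <= size u &
    (forall j, j < x -> nth a0 u (i + j) = nth a0 u (i + (x + y) + j)) /\
    (forall j, j < y -> nth a0 u (i + x + j) = nth a0 u (k + (y - j.+1)))].
Proof.
case=> h [hM hN hR /and3P[/infixP[p [s uE]] /infixP[p' [s' uE']] _]].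
set X := h [:: inl var_x]; set Y := h [:: inl var_y1].
have XYX : h [:: inl var_x; inl var_y1; inl var_x] = X ++ Y ++ X.
  by rewrite -(hM [:: _]) -(hM [:: _]).
have sX : 0 < size X by rewrite lt0n size_eq0; apply/eqP/hN.
have sY : 0 < size Y by rewrite lt0n size_eq0; apply/eqP/hN.
rewrite XYX in uE; rewrite hR -/Y in uE'.
have uS : size u = size p + (size X + (size Y + size X) + size s).
  by rewrite uE !size_cat.
have uS' : size u = size p' + (size Y + size s').
  by rewrite uE' !size_cat size_rev.
exists (size p), (size p'), (size X), (size Y); split=> //; try lia.
split=> j jlt.
  rewrite uE -!catA -!addnA !nth_cat_addn.
  by rewrite !nth_cat jlt.
rewrite {1}uE uE' -!catA -!addnA !nth_cat_addn !nth_cat size_rev.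
have -> : size Y - j.+1 < size Y by lia.
rewrite jlt nth_rev; last by lia.
by rewrite subnSK // subKn // ltnW.
Qed.

Lemma encode_word_avoids N (w : seq 'I_4) :
  square_free w -> N %/ 18 + 3 <= size w -> avoids phi1 (encode_word N w).
Proof.
move=> sfw nN /(phi1_occurs_indices ord0)[i [k [x [y [x0 y0]]]]].
rewrite size_tuple => ixN kyN [EX EY].
apply: (@encode_no_gap (size w) (fun k => nth ord0 w k) _ _ N i k x y) => //.
- move=> a q q0 aq E; apply: (square_free_nth (x0 := ord0) sfw q0 aq).
  by move=> j jq; apply/val_inj/E.
- by move=> j jx; rewrite -!(@nth_encode_word N) ?EX //; lia.
- by move=> j jx; rewrite -!(@nth_encode_word N) ?EY //; lia.
Qed.

(** A word of length [N] contains only [N %/ 18] complete blocks. These determine all but the last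
    three letters of the preimage, which are therefore compared separately. *)
Lemma encode_word_inj N (v w : seq 'I_4) :
  size v = N %/ 18 + 3 -> size w = N %/ 18 + 3 ->
  drop (N %/ 18) v = drop (N %/ 18) w ->
  encode_word N v = encode_word N w -> v = w.
Proof.
move=> sv sw Ed Ee.
rewrite -(cat_take_drop (N %/ 18) v) -(cat_take_drop (N %/ 18) w) Ed.
congr (_ ++ _).
have [st st'] : size (take (N %/ 18) v) = N %/ 18 /\
                size (take (N %/ 18) w) = N %/ 18.
  by rewrite !size_takel ?sv ?sw; lia.
apply: (@eq_from_nth _ ord0); rewrite st ?st' // => i iN.
rewrite !nth_take //; apply/val_inj/codeword_inj_prefix; rewrite ?ltn_ord //.
move=> c c7.
have cN : i * 18 + c < N by lia.
have := congr1 (fun u : N.-tuple 'I_4 => val (nth ord0 u (i * 18 + c))) Ee.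
rewrite /= !nth_encode_word // !encode_block //; lia.
Qed.

(** Sending a square-free word to its encoding and its last three letters is injective; the last
    three letters cost only a constant factor. *)
Lemma exp2_leq_num_avoiding N :
  2 ^ (N %/ 18 + 3) <= num_avoiding 4 phi1 N * size (square_free_words 'I_4 3).
Proof.
set n := N %/ 18.
apply: leq_trans (@exp2_leq_square_free_words 'I_4 (n + 3) _) _.
  by rewrite card_ord.
rewrite /num_avoiding cardE -(size_allpairs pair).
rewrite -(size_map (fun w => (encode_word N w, drop n w))).
apply: uniq_leq_size.
  rewrite map_inj_in_uniq ?square_free_words_uniq // => v w.
  move=> /mem_square_free_words[sv _] /mem_square_free_words[sw _] E.
  exact: (encode_word_inj sv sw (congr1 snd E) (congr1 fst E)).
move=> _ /mapP[w /mem_square_free_words[sw sfw] ->].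
apply/allpairsP; exists (encode_word N w, drop n w); split=> //.
  by rewrite mem_enum /=; apply/asboolP; apply: encode_word_avoids; rewrite ?sw.
apply/mem_square_free_words; split; first by rewrite size_drop sw addKn.
apply: square_free_infix sfw.
rewrite /= -[X in infix _ X](cat_take_drop n w).
by apply: suffix_infix; apply: suffix_suffix.
Qed.

(** * Infinitude and exponential growth *)

Lemma avoidable_phi1 : avoidable 4 phi1.
Proof.
move=> /finite_seqP[S SE].
(* An avoiding word of this length is longer than every word of [S]. *)
pose N := (\max_(u <- S) size u).+1.
have : 0 < num_avoiding 4 phi1 N.
  have := exp2_leq_num_avoiding N.
  by case: (num_avoiding _ _ _) => //; rewrite mul0n leqn0 expn_eq0.
case/card_gt0P=> u /= /asboolP uA.
have uS : tval u \in S.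
  have : [set v : seq 'I_4 | avoids phi1 v]%classic (tval u) by exact: uA.
  by rewrite SE.
by have := @leq_bigmax_seq _ S xpredT size _ uS isT; rewrite size_tuple /N ltnn.
Qed.

Section Growth.
Local Open Scope ring_scope.

Lemma exponential_growth_phi1 (R : realType) :
  exponential_growth R (num_avoiding 4 phi1).
Proof.
split; last first.
  exists 1, 4%:R; split; rewrite ?ltr01 ?ltr1n // => N.
  rewrite mul1r -natrX ler_nat (leq_trans (max_card _)) //.
  by rewrite card_tuple card_ord.
set K := size (square_free_words 'I_4 3).
have K0 : (0 < K)%N.
  have := exp2_leq_num_avoiding 0; rewrite -/K.
  by case: K => //; rewrite muln0.
(* Any base [c > 1] with [c ^+ 18 <= 2] would do, since [N <= 18 * (N %/ 18 + 3)]. *)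
exists (K%:R^-1), (37%:R / 36%:R); split; first by rewrite invr_gt0 ltr0n.
  by rewrite ltr_pdivlMr ?ltr0n // mul1r ltr_nat.
move=> N; rewrite mulrC ler_pdivrMr ?ltr0n // -natrM.
apply: le_trans (_ : (2 ^ (N %/ 18 + 3))%:R <= _); last first.
  by rewrite ler_nat exp2_leq_num_avoiding.
set c : R := 37%:R / 36%:R.
have c1 : 1 <= c by rewrite /c; lra.
have c18 : c ^+ 18 <= 2%:R.
  (* Rounding up after the powers 2 and 6 keeps the fractions small. *)
  have c2 : c ^+ 2 <= 106%:R / 100%:R by rewrite /c; lra.
  have c6 : c ^+ 6 <= 12%:R / 10%:R.
    rewrite (exprM c 2 3).
    apply: le_trans (_ : (106%:R / 100%:R) ^+ 3 <= _); last lra.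
    by apply: lerXn2r => //; rewrite nnegrE; [apply: exprn_ge0; lra|lra].
  rewrite (exprM c 6 3).
  apply: le_trans (_ : (12%:R / 10%:R) ^+ 3 <= _); last lra.
  by apply: lerXn2r => //; rewrite nnegrE; [apply: exprn_ge0; lra|lra].
apply: le_trans (_ : c ^+ (18 * (N %/ 18 + 3)) <= _).
  by apply: ler_weXn2l => //; lia.
rewrite exprM natrX; apply: lerXn2r => //; rewrite nnegrE ?ler0n //.
by apply: exprn_ge0; lra.
Qed.

End Growth.

Theorem theorem2p3 (R : realType) :
  avoidable 4 phi1 /\ exponential_growth R (num_avoiding 4 phi1).
Proof. exact: (conj avoidable_phi1 (exponential_growth_phi1 R)). Qed.
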